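(* Let $G$ be a branch group acting on a rooted tree $T$, and let $M<G$ be a maximal subgroup of infinite index of $G$. Then $M$ is a branch group for its action on $T$.
   Context: All rooted trees are infinite and locally finite. For a rooted tree $T$, the $n$-th level $L_n$ is the set of vertices at distance $n$ from the root, and for vertices $v,w$ one writes $v\leq w$ if $v$ lies on the simple path from the root to $w$; $T_v$ is the subtree with vertex set $\{w : v\leq w\}$, rooted at $v$. $T$ is spherically homogeneous if all vertices of the same level have the same degree. $\mathrm{Aut}(T)$ is the group of automorphisms of $T$ fixing the root. For $G\leq \mathrm{Aut}(T)$ and a vertex $v$, the rigid stabiliser $\mathrm{Rist}_G(v)$ is the subgroup of all $g\in G$ fixing every vertex outside $T_v$. For $n\in\mathbb{N}$, $\mathrm{Rist}_G(n)$ is the subgroup generated by $\bigcup_{v\in L_n}\mathrm{Rist}_G(v)$. A branch group acting on $T$ is a subgroup $G\leq\mathrm{Aut}(T)$, with $T$ a spherically homogeneous rooted tree, such that (i) $G$ acts transitively on every level $L_n$, (ii) $\mathrm{Rist}_G(v)\neq\{1\}$ for every vertex $v$, and (iii) $\mathrm{Rist}_G(n)$ has finite index in $G$ for every $n\in\mathbb{N}$. *)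

(* Defs.v *)
From HB Require Import structures.
From mathcomp Require Import all_boot.
From mathcomp Require Import all_classical.

Set Implicit Arguments.
Unset Strict Implicit.
Unset Printing Implicit Defensive.

Local Open Scope classical_set_scope.
Local Open Scope card_scope.

Section Groups.
Variable gT : groupType.
Implicit Types (x y : gT) (G H M X : set gT).
Local Open Scope group_scope.

Definition subgroup H : Prop :=
  [/\ H 1,
      forall x y, H x -> H y -> H (x * y)
    & forall x, H x -> H x^-1].

Definition generated X : set gT := smallest subgroup X.

Definition left_coset x H : set gT := [set x * h | h in H].

Definition finite_index H G : Prop :=
  finite_set [set left_coset x H | x in G].

Definition maximal_subgroup M G : Prop :=
  [/\ subgroup M, M `<` G
    & forall H, subgroup H -> M `<=` H -> H `<=` G -> H = M \/ H = G].

End Groups.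

Section Graphs.
Variables (V : choiceType) (adj : rel V).
Implicit Types (x y : V) (p : seq V).

(* As in the library, [p] does not contain the starting point [x], so that the
   length of the path is [size p]. *)
Definition path_between x y p : Prop := path adj x p /\ last x p = y.

Definition simple_path x y p : Prop := path_between x y p /\ uniq (x :: p).

Definition at_distance x y (n : nat) : Prop :=
  (exists2 p, path_between x y p & size p = n) /\
  (forall p, path_between x y p -> n <= size p).

Definition neighbours x : set V := [set y | adj x y].

End Graphs.

Record rootedTree := RootedTree {
  vertex :> choiceType;
  adj : rel vertex;
  root : vertex;
  adj_sym : symmetric adj;
  adj_irr : irreflexive adj;
  tree_path : forall x y, exists! p, simple_path adj x y p;
  tree_infinite : infinite_set [set: vertex];
  tree_locally_finite : forall x, finite_set (neighbours adj x)
}.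

Arguments adj {T} : rename.
Arguments root {T} : rename.

Section Trees.
Variable T : rootedTree.
Implicit Types (v w : T) (n : nat).

Definition level n : set T := [set v | at_distance adj root v n].

Definition below v w : Prop :=
  exists2 p, simple_path adj root w p & v \in root :: p.

(* The degrees are compared as cardinals of (finite) sets of neighbours. *)
Definition spherically_homogeneous : Prop :=
  forall n v w, level n v -> level n w ->
    neighbours adj v #= neighbours adj w.

End Trees.

Arguments level : clear implicits.
Arguments spherically_homogeneous : clear implicits.

(* The inverse is uniquely determined by the underlying map, see [aut_inj]. *)
Record aut (T : rootedTree) := Aut {
  aut_fun :> T -> T;
  aut_inv : T -> T;
  aut_funK : cancel aut_fun aut_inv;
  aut_invK : cancel aut_inv aut_fun;
  aut_adj : {mono aut_fun : x y / adj x y};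
  aut_root : aut_fun root = root
}.

Section AutGroup.
Variable T : rootedTree.
Implicit Types g h k : aut T.

Lemma aut_inj g h : g =1 h -> g = h.
Proof.
case: g h => [f i fK iK fA fr] [f' i' f'K i'K f'A f'r] /= E.
have Ef : f = f' by apply/funext.
subst f'.
have Ei : i = i' by apply/funext => x; rewrite -{1}[x]i'K fK.
subst i'.
by congr Aut; exact: Prop_irrelevance.
Qed.

HB.instance Definition _ := gen_eqMixin (aut T).
HB.instance Definition _ := gen_choiceMixin (aut T).

Lemma aut1_adj : {mono @id T : x y / adj x y}.
Proof. by []. Qed.

Definition aut1 : aut T :=
  @Aut T id id (fun _ => erefl) (fun _ => erefl) aut1_adj erefl.

Lemma autM_adj g h : {mono g \o h : x y / adj x y}.
Proof. by move=> x y /=; rewrite !aut_adj. Qed.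

Lemma autM_root g h : (g \o h) root = root.
Proof. by rewrite /= !aut_root. Qed.

Definition autM g h : aut T :=
  Aut (can_comp (aut_funK g) (aut_funK h)) (can_comp (aut_invK h) (aut_invK g))
      (autM_adj g h) (autM_root g h).

Lemma autV_adj g : {mono aut_inv g : x y / adj x y}.
Proof. by move=> x y; rewrite -(aut_adj g) !aut_invK. Qed.

Lemma autV_root g : aut_inv g root = root.
Proof. by rewrite -{1}(aut_root g) aut_funK. Qed.

Definition autV g : aut T :=
  Aut (aut_invK g) (aut_funK g) (autV_adj g) (autV_root g).

Lemma autMA : associative autM.
Proof. by move=> g h k; apply: aut_inj. Qed.

Lemma aut1M : left_id aut1 autM.
Proof. by move=> g; apply: aut_inj. Qed.

Lemma autM1 : right_id aut1 autM.
Proof. by move=> g; apply: aut_inj. Qed.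

Lemma autVM : left_inverse aut1 autV autM.
Proof. by move=> g; apply: aut_inj => x /=; rewrite aut_funK. Qed.

Lemma autMV : right_inverse aut1 autV autM.
Proof. by move=> g; apply: aut_inj => x /=; rewrite aut_invK. Qed.

HB.instance Definition _ := isGroup.Build (aut T) autMA aut1M autM1 autVM autMV.

End AutGroup.

Section BranchGroups.
Variable T : rootedTree.
Implicit Types (G : set (aut T)) (v w : T) (n : nat).

Definition rist G v : set (aut T) :=
  [set g | G g /\ forall w, ~ below v w -> g w = w].

Definition rist_level G n : set (aut T) :=
  generated (\bigcup_(v in level T n) rist G v).

Definition level_transitive G : Prop :=
  forall n v w, level T n v -> level T n w -> exists2 g, G g & g v = w.

Definition branch_group G : Prop :=
  [/\ spherically_homogeneous T,
      subgroup G,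
      level_transitive G,
      forall v, rist G v <> [set 1%g]
    & forall n, finite_index (rist_level G n) G].

End BranchGroups.

(* Main.v *)
Require Import Defs.
From mathcomp Require Import all_boot.
From mathcomp Require Import all_classical.
(* Again, because fingraph shadows [root]. *)
Require Import Defs.

(* Write R_u for the rigid stabiliser of u in G, R(n) for the product of the R_u
   with u of level n, and M for the maximal subgroup.

   A nontrivial normal subgroup N of G contains the derived subgroup of some
   R(n), so G/N is virtually abelian.  As M has infinite index, it contains no
   such N: otherwise, with H = R(n), the module H / (M \cap H) over the finite
   group G/H would be simple and finitely generated, hence finite.  So M N = G
   for every such N; with N = R(n) this gives level transitivity.

   Let D = M \cap R(n), and let D_u be its projections to the R_u.  By
   maximality, either M contains the product of the D_u, which is then both D
   and the rigid level stabiliser of M, or D_u = R_u for all u (D is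
   "subdirect").  In the subdirect case the rigid level stabiliser of M is normal
   in G, hence trivial; it remains to exclude this by finding a nontrivial
   element of M in R_v.

   Let B be generated by the elements of D with minimal support.  Those
   with distinct supports commute, and the product C of the projections of B is
   normal in G.  Given 1 <> x in R_v, G = M C gives c = x t in M with t in C.
   The coordinates of c outside T_v are killed one at a time: on the next one, c
   agrees with a b, where a (resp. b) is generated by minimal elements that do
   (resp. do not) meet the coordinates already killed.  Then c b^-1 commutes
   with the elements of the first kind, so a commutes with its conjugates in
   this coordinate, which forces it to be trivial there. *)

Set Implicit Arguments.
Unset Strict Implicit.
Unset Printing Implicit Defensive.

Local Open Scope classical_set_scope.
Local Open Scope group_scope.

(** * Subgroups, products, cosets and indices in an abstract group *)

Section Groups.
Variable gT : groupType.
Implicit Types (x y g h : gT) (G H K M N X : set gT) (s : seq gT).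

Definition normalised_by K X := forall g x, K g -> X x -> X (g * x * g^-1).

Definition mul_set X K : set gT := [set g |
  exists x y, [/\ X x, K y & g = x * y]].

Lemma subgroupJ K g x : subgroup K -> K g -> K x -> K (g * x * g^-1).
Proof. by move=> [_ KM KV] Kg Kx; apply: (KM); [exact: KM|exact: KV]. Qed.

Lemma subgroupR K g x : subgroup K -> K g -> K x -> K (g * x * g^-1 * x^-1).
Proof.
by move=> sK Kg Kx; case: (sK) => _ KM KV; apply: KM;
  [exact: subgroupJ|exact: KV].
Qed.

Lemma generated_subgroup X : subgroup (generated X).
Proof.
split=> [K [[]]|x y gx gy K KX|x gx K KX] //.
- by case: (KX) => -[_ KM _] _; apply: KM; [exact: gx|exact: gy].
- by case: (KX) => -[_ _ KV] _; apply: KV; exact: gx.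
Qed.

Lemma generated_min X K : subgroup K -> X `<=` K -> generated X `<=` K.
Proof. exact: smallest_sub. Qed.

Lemma sub_generated X : X `<=` generated X.
Proof. exact: sub_gen_smallest. Qed.

Lemma subgroup_conj_preim N g :
  subgroup N -> subgroup [set x | N (g * x * g^-1)].
Proof.
move=> [N1 NM NV]; split=> [|x y Nx Ny|x Nx] /=; first by rewrite !gnorm.
- by have := NM _ _ Nx Ny; rewrite !gnorm.
- by have := NV _ Nx; rewrite !gnorm.
Qed.

Lemma generated_normalised K X :
  normalised_by K X -> normalised_by K (generated X).
Proof.
move=> KX g x Kg; move: x; apply: generated_min.
  exact/subgroup_conj_preim/generated_subgroup.
by move=> y Xy /=; apply: sub_generated; exact: KX.
Qed.

Lemma subgroup_mul_set M N :
  subgroup M -> subgroup N -> normalised_by M N -> subgroup (mul_set M N).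
Proof.
move=> [M1 MM MV] [N1 NM NV] nMN; split.
- by exists 1, 1; rewrite mulg1.
- move=> _ _ [m [n [Mm Nn ->]]] [m' [n' [Mm' Nn' ->]]].
  exists (m * m'), (m'^-1 * n * m' * n'); split;
    [exact: MM| |by rewrite !gnorm].
  by apply: NM => //; have := nMN _ _ (MV _ Mm') Nn; rewrite !gnorm.
- move=> _ [m [n [Mm Nn ->]]].
  exists m^-1, (m * n^-1 * m^-1); split; [exact: MV| |by rewrite !gnorm].
  exact/nMN/NV.
Qed.

(** As [M] normalises [N], the product [mul_set M N] is a subgroup between [M] and [G]. *)
Lemma maximal_dichotomy M G N : maximal_subgroup M G -> subgroup G ->
    subgroup N -> N `<=` G -> normalised_by M N ->
  N `<=` M \/ G `<=` mul_set M N.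
Proof.
move=> [sM [MG nGM] maxM] [G1 GM GV] sN NG nMN.
case: (maxM (mul_set M N)); first exact: subgroup_mul_set.
- by move=> m Mm; exists m, 1; rewrite mulg1; split=> //; case: sN.
- by move=> _ [m [n [Mm Nn ->]]]; apply: GM; [exact: MG|exact: NG].
- move=> E; left=> n Nn; rewrite -E.
  by exists 1, n; rewrite mul1g; split=> //; case: sM.
- by move=> E; right; rewrite E.
Qed.

Lemma left_comul_set M x m :
  subgroup M -> M m -> left_coset (x * m) M = left_coset x M.
Proof.
move=> [M1 MM MV] Mm; apply/seteqP; split=> _ [y My <-].
- by exists (m * y); [exact: MM|rewrite mulgA].
- by exists (m^-1 * y); [apply: MM => //; exact: MV|rewrite !gnorm].
Qed.

Lemma left_coset_mull M x y :
  left_coset (x * y) M = [set x * z | z in left_coset y M].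
Proof.
apply/seteqP; split=> [_ [z Mz <-]|_ [_ [z Mz <-] <-]].
- by exists (y * z); [exists z|rewrite mulgA].
- by exists z => //; rewrite mulgA.
Qed.

Lemma left_coset_mem M x y :
  subgroup M -> left_coset x M = left_coset y M -> M (x^-1 * y).
Proof.
move=> [M1 MM MV] E.
have [z Mz <-] : left_coset x M y by rewrite E; exists 1; rewrite ?mulg1.
by rewrite !gnorm.
Qed.

Lemma finite_indexP H G : subgroup H -> finite_index H G ->
  exists2 s : seq gT, (forall x, x \in s -> G x) &
    forall g, G g -> exists2 x, x \in s & H (x^-1 * g).
Proof.
move=> sH fH.
have preX C : exists p, (exists2 x, G x & left_coset x H = C) ->
    G p /\ left_coset p H = C.
  have [[x Gx xC]|nC] := pselect (exists2 x, G x & left_coset x H = C).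
    by exists x.
  (* Sets that are not cosets get the default value [1]. *)
  by exists 1.
have [pre preP] := choice preX.
have /finite_seqP[s Es] := finite_image pre fH.
exists s => [x xs|g Gg].
  have : [set` s] x by [].
  by rewrite -Es => -[C CG <-]; have [] := preP C CG.
have Cg : exists2 x, G x & left_coset x H = left_coset g H by exists g.
have [_ E] := preP _ Cg.
exists (pre (left_coset g H)); last exact: left_coset_mem.
by have : [set` s] (pre (left_coset g H)) by rewrite -Es;
  exists (left_coset g H).
Qed.


Lemma finite_index_seq M G s : subgroup M ->
  (forall g, G g -> exists2 x, x \in s & M (x^-1 * g)) -> finite_index M G.
Proof.
move=> sM Gs.
apply: (@sub_finite_set _ _ [set left_coset x M | x in [set` s]]).
  move=> _ [g Gg <-]; have [x xs Mxg] := Gs g Gg.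
  by exists x => //; rewrite -(left_comul_set x sM Mxg) mulVKg.
exact/finite_image/finite_seq.
Qed.

Lemma finite_index_sub H M G : subgroup H -> subgroup M -> H `<=` M ->
  finite_index H G -> finite_index M G.
Proof.
move=> sH sM HM /(finite_indexP sH)[s _ Gs].
apply: (@finite_index_seq M G s) => // g /Gs[x xs Hxg].
by exists x => //; exact: HM.
Qed.

(** Every coset of the intersection in [M] is the trace on [M] of a coset of [H]. *)
Lemma finite_index_setI H M G : subgroup H -> subgroup M -> M `<=` G ->
  finite_index H G -> finite_index (M `&` H) M.
Proof.
move=> sH sM MG fH.
apply: (@sub_finite_set _ _ [set M `&` C | C in [set left_coset x H | x in G]]);
  last exact: finite_image.
move=> _ [x Mx <-]; exists (left_coset x H); first by exists x => //; exact: MG.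
case: sM => M1 MM MV.
apply/seteqP; split=> [z [Mz [y Hy E]]|_ [y [My Hy] <-]].
  exists y => //; split=> //.
  by have := MM _ _ (MV _ Mx) Mz; rewrite -E !gnorm.
by split; [exact: MM|exists y].
Qed.

(** The cyclic group of [h]; the pair [i], [j] stands for the integer exponent [i - j]. *)
Definition powers h : set gT := [set x | exists i j, x = h ^+ i * h ^- j].

Lemma powers_subgroup h : subgroup (powers h).
Proof.
have C i j : commute (h ^+ i) (h ^- j).
  exact/commuteV/commuteX2/commute_refl.
split=> [|_ _ [i [j ->]] [k [l ->]]|_ [i [j ->]]].
- by exists 0%N, 0%N; rewrite expg0 !gnorm.
- exists (i + k)%N, (l + j)%N; rewrite !expgnDr invgM -!mulgA; congr (_ * _).
  by rewrite mulgA -(C k j) mulgA.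
- by exists j, i; rewrite invgM invgK.
Qed.

Lemma mem_powers h : powers h h.
Proof. by exists 1%N, 0%N; rewrite expg1 expg0 !gnorm. Qed.

Lemma powers_min h K : subgroup K -> K h -> powers h `<=` K.
Proof.
move=> [K1 KM KV] Kh _ [i [j ->]].
have KX n : K (h ^+ n) by elim: n => [|n IH]; rewrite ?expgS //; exact: KM.
by apply: KM => //; exact: KV.
Qed.

(** * Maximal subgroups containing the commutators of a normal subgroup of finite index *)

Section AbelianModuloMaximal.
Variables (G H M : set gT).
Hypotheses (sG : subgroup G) (maxM : maximal_subgroup M G).
Hypotheses (sH : subgroup H) (HG : H `<=` G) (nGH : normalised_by G H).
Hypothesis fH : finite_index H G.
Hypothesis cHM : forall a b, H a -> H b -> M (a * b * a^-1 * b^-1).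

(** As the commutators of [H] lie in [M], these [P] correspond to the subgroups of an abelian group,
    the quotient of [H] by its intersection with [M]. *)
Definition between P := [/\ subgroup P, P `<=` H & M `&` H `<=` P].

Lemma maximal_subgroupW : subgroup M. Proof. by case: maxM. Qed.

Lemma maximal_sub : M `<=` G. Proof. by case: maxM => _ [MG _]. Qed.

Lemma between_comm P a b : between P -> H a -> H b -> P (a * b * a^-1 * b^-1).
Proof.
move=> [_ _ EP] Ha Hb; apply: EP; split; first exact: cHM.
exact: subgroupR.
Qed.

Lemma between_normal P a b : between P -> H a -> P b -> P (a * b * a^-1).
Proof.
move=> bP Ha Pb; case: (bP) => -[_ PM _] PH _.
by have := PM _ _ (between_comm bP Ha (PH _ Pb)) Pb; rewrite !gnorm.
Qed.

Lemma subgroupX K a n : subgroup K -> K a -> K (a ^+ n).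
Proof.
by move=> [K1 KM _] Ka; elim: n => [|n IH] //; rewrite expgS; exact: KM.
Qed.

(** [H] is abelian modulo [P]; the factor [e] absorbs the commutators. *)
Lemma between_expM P a b n : between P -> H a -> H b ->
  exists2 e, P e & (a * b) ^+ n = a ^+ n * b ^+ n * e.
Proof.
move=> bP Ha Hb; case: (bP) => -[P1 PM PV] PH _; case: (sH) => _ HM HV.
elim: n => [|n [e Pe IH]]; first by exists 1; rewrite ?expg0 ?mulg1.
have Han := subgroupX n sH Ha; have Hbn := subgroupX n sH Hb.
exists ((b ^+ n)^-1 * (b^-1 * (a ^+ n)^-1 * b * a ^+ n) * b ^+ n * e).
  apply: PM => //.
  have /(between_normal bP (HV _ Hbn)) :=
    between_comm bP (HV _ Hb) (HV _ Han).
  by rewrite !gnorm.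
by rewrite !expgS IH -!mulgA !mulVKg; congr (_ * _); rewrite !gnorm.
Qed.

Lemma subgroup_setI K L : subgroup K -> subgroup L -> subgroup (K `&` L).
Proof.
move=> [K1 KM KV] [L1 LM LV].
split=> [|x y [Kx Lx] [Ky Ly]|x [Kx Lx]]; first by [].
  by split; [exact: KM|exact: LM].
by split; [exact: KV|exact: LV].
Qed.

Lemma between_setI : between (M `&` H).
Proof.
by split=> [|? []|] //; apply: subgroup_setI => //; exact: maximal_subgroupW.
Qed.

Lemma between_adjoin P h : between P -> H h -> between (mul_set (powers h) P).
Proof.
move=> bP Hh; case: (bP) => sP PH EP; case: (sH) => _ HM _.
have hH : powers h `<=` H by exact: powers_min.
split.
- apply: subgroup_mul_set => //; first exact: powers_subgroup.
  by move=> g x /hH Hg Px; exact: between_normal.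
- by move=> _ [x [y [/hH Hx /PH Hy ->]]]; exact: HM.
- move=> e /EP Pe; exists 1, e; rewrite mul1g; split=> //.
  by case: (powers_subgroup h).
Qed.

(** For [s] in [H], the preimage of the subgroup that [s] generates in the quotient of [H] by its
    intersection with [M]. *)
Fixpoint adjoin s : set gT :=
  if s is h :: s' then mul_set (powers h) (adjoin s') else M `&` H.

Lemma between_adjoins s : (forall x, x \in s -> H x) -> between (adjoin s).
Proof.
elim: s => [|h s IH] sHs /=; first exact: between_setI.
apply: between_adjoin; last by apply: sHs; rewrite mem_head.
by apply: IH => x xs; apply: sHs; rewrite in_cons xs orbT.
Qed.

Lemma mem_adjoin s h : (forall x, x \in s -> H x) -> h \in s -> adjoin s h.
Proof.
elim: s => [|k s IH] //= sHs; rewrite in_cons.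
have sHs' x : x \in s -> H x by move=> xs; apply: sHs; rewrite in_cons xs orbT.
case: (between_adjoins sHs') => -[P1 _ _] _ _.
case/predU1P => [->|/IH hs]; first by exists k, 1; rewrite mulg1; split=> //;
  exact: mem_powers.
exists 1, h; rewrite mul1g; split=> //; last exact: hs.
by case: (powers_subgroup k).
Qed.

Lemma adjoin_min s K : subgroup K -> M `&` H `<=` K ->
  (forall x, x \in s -> K x) -> adjoin s `<=` K.
Proof.
move=> sK EK; elim: s => [|h s IH] //= sKs _ [x [y [hx sy ->]]].
case: (sK) => _ KM _; apply: KM.
  by apply: powers_min hx => //; apply: sKs; rewrite mem_head.
by apply: IH sy => z zs; apply: sKs; rewrite in_cons zs orbT.
Qed.

(* Multiplication by [n] on the simple module [H / (M `&` H)] is either zero or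
   onto. *)
Lemma exp_dichotomy n :
  (forall a, H a -> M (a ^+ n)) \/
  (forall z, H z -> exists a e, [/\ H a, (M `&` H) e & z = a ^+ n * e]).
Proof.
pose K := [set z | exists a e, [/\ H a, (M `&` H) e & z = a ^+ n * e]].
have bE := between_setI; case: (bE) => sE _ _; case: (sE) => E1 EM EV.
case: (sH) => H1 HM HV; have HX := subgroupX n sH.
have sK : subgroup K.
  split.
  - by exists 1, 1; rewrite expg1n mulg1.
  - move=> _ _ [a [e [Ha Ee ->]]] [b [f [Hb Ef ->]]].
    have [q Eq abn] := between_expM n bE Ha Hb.
    exists (a * b), (q^-1 * (b ^- n * e * b ^+ n) * f); split; first exact: HM.
      apply: (EM) Ef; apply: (EM); first exact: EV.
      by have := between_normal bE (HV _ (HX _ Hb)) Ee; rewrite invgK.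
    by rewrite abn !gnorm.
  - move=> _ [a [e [Ha Ee ->]]].
    exists a^-1, (a ^+ n * e^-1 * a ^- n); split; first exact: HV.
      by apply: between_normal => //; [exact: HX|exact: EV].
    by rewrite expVgn !gnorm.
have KH : K `<=` H.
  by move=> _ [a [e [/HX Han [_ He] ->]]]; exact: HM.
have nMK : normalised_by M K.
  move=> m _ Mm [a [e [Ha [Me He] ->]]]; have Gm := maximal_sub Mm.
  exists (m * a * m^-1), (m * e * m^-1); split.
  - exact: nGH.
  - by split; [apply: subgroupJ => //; exact: maximal_subgroupW|exact: nGH].
  - have -> : (m * a * m^-1) ^+ n = m * a ^+ n * m^-1.
      by have := conjXg a m^-1 n; rewrite !conjgE !invgK !mulgA.
    by rewrite !gnorm.
have [KM|GMK] := maximal_dichotomy maxM sG sK (subset_trans KH HG) nMK.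
  by left=> a Ha; apply: KM; exists a, 1; rewrite mulg1.
right=> z Hz; have [m [k [Mm Kk zE]]] := GMK _ (HG Hz).
(* [m] lies in [H] too, so conjugating it by [a ^+ n] keeps it in the intersection of [M] and
   [H]. *)
have Em : (M `&` H) m.
  split=> //; suff -> : m = z * k^-1 by apply: HM => //; exact/HV/KH.
  by rewrite zE !gnorm.
case: Kk zE => a [e [Ha Ee ->]] zE.
exists a, (a ^- n * m * a ^+ n * e); split=> //; last by rewrite zE !gnorm.
apply: EM => //.
by have := between_normal bE (HV _ (HX _ Ha)) Em; rewrite invgK.
Qed.

(** The quotient of [H] by [P] is cyclic, killed by [n] and divisible by [n], hence trivial. *)
Lemma torsion_adjoin P h n : between P -> H h -> H `<=` mul_set (powers h) P ->
  P (h ^+ n) -> (forall z, H z -> exists a e,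
    [/\ H a, (M `&` H) e & z = a ^+ n * e]) -> H `<=` P.
Proof.
move=> bP Hh HhP Phn Hn z /Hn[a [e [Ha Ee ->]]].
case: (bP) => sP PH EP; case: (sP) => P1 PM PV.
apply: (PM); last exact: EP.
have [_ [p [[i [j ->]] Pp aE]]] := HhP _ Ha; move: aE => ->.
have Hu : H (h ^+ i * h ^- j).
  by apply: powers_min Hh _ _ => //; exists i, j.
have [q Pq ->] := between_expM n bP Hu (PH _ Pp).
apply: (PM) => //; apply: (PM); last exact: subgroupX.
rewrite expgMn; last exact/commuteV/commuteX2/commute_refl.
rewrite -!expVgn -!expgnA !(mulnC _ n) !expgnA.
by apply: PM; apply: subgroupX => //; rewrite expVgn; exact: PV.
Qed.

(** If squaring does not send [H] into [M], it is onto modulo the intersection. This forces [h] to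
    have finite order modulo [P], and by [torsion_adjoin] the corresponding power map is not onto,
    so it is zero. *)
Lemma exists_exponent_adjoin P h : between P -> H h ->
    H `<=` mul_set (powers h) P -> ~ H `<=` P ->
  exists2 n, (0 < n)%N & forall a, H a -> M (a ^+ n).
Proof.
move=> bP Hh HhP nHP; case: (bP) => sP PH EP; case: (sP) => P1 PM PV.
case: (exp_dichotomy 2) => [?|H2]; first by exists 2.
suff [n n0 Phn] : exists2 n, (0 < n)%N & P (h ^+ n).
  case: (exp_dichotomy n) => [?|Hn]; first by exists n.
  by case: nHP; exact: torsion_adjoin Phn Hn.
have [y [e [Hy Ee hE]]] := H2 _ Hh.
have [_ [p [[i [j ->]] Pp yE]]] := HhP _ Hy.
have Hu : H (h ^+ i * h ^- j).
  by apply: powers_min Hh _ _ => //; exists i, j.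
have [q Pq y2E] := between_expM 2 bP Hu (PH _ Pp).
have C : commute (h ^+ i) (h ^- j) by exact/commuteV/commuteX2/commute_refl.
pose r := p ^+ 2 * q * e.
have Pr : P r by apply: (PM); [apply: (PM) => //; exact: PM|exact: EP].
have {}hE : h = h ^- (j * 2) * h ^+ (i * 2) * r.
  rewrite {1}hE yE y2E C expgMn; last exact: commute_sym.
  by rewrite expVgn -!expgnA /r !mulgA.
(* Modulo [P], [h] is the square of [h ^+ i * h ^- j]. The two exponents obtained have different
   parity, so they differ. *)
have Pd : P (h ^- (i * 2) * h ^+ (j * 2).+1).
  suff -> : h ^- (i * 2) * h ^+ (j * 2).+1 = r by [].
  by rewrite expgSr [X in _ * (_ * X)]hE !gnorm.
case: (leqP (i * 2) (j * 2).+1) => ij.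
  exists ((j * 2).+1 - i * 2)%N.
    by rewrite subn_gt0 ltn_neqAle ij andbT; apply/eqP => /(congr1 odd) /=;
      rewrite !oddM !andbF.
  rewrite expgnFr //;
    suff <- : h ^- (i * 2) * h ^+ (j * 2).+1 = h ^+ (j * 2).+1 * h ^- (i * 2)
    by [].
  exact/esym/commuteV/commuteX2/commute_refl.
exists (i * 2 - (j * 2).+1)%N; first by rewrite subn_gt0.
rewrite expgnFr; last exact: ltnW.
have := PV _ Pd; rewrite invgM invgK.
suff -> : h ^- (j * 2).+1 * h ^+ (i * 2) = h ^+ (i * 2) * h ^- (j * 2).+1 by [].
exact/esym/commuteV/commuteX2/commute_refl.
Qed.

(* A finitely generated abelian group has a nontrivial cyclic quotient, which is
   not divisible, so some [n > 0] kills the simple module [H / (M `&` H)]. *)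
Lemma exists_exponent s : (forall x, x \in s -> H x) -> H `<=` adjoin s ->
  ~ H `<=` M -> exists2 n, (0 < n)%N & forall a, H a -> M (a ^+ n).
Proof.
elim: s => [|h s IH] sHs Hs nHM.
  by case: nHM => x /Hs[].
have sHs' x : x \in s -> H x by move=> xs; apply: sHs; rewrite in_cons xs orbT.
(* Either [h] is redundant and is dropped, or it generates the nontrivial quotient of [H] by
   [adjoin s]. *)
have [Hs'|nHs'] := pselect (H `<=` adjoin s); first exact: IH.
apply: exists_exponent_adjoin Hs nHs'; first exact: between_adjoins.
by apply: sHs; rewrite mem_head.
Qed.

(** A finitely generated abelian group of finite exponent is finite: each generator contributes only
    its powers below [n]. *)
Lemma finite_cosets_adjoin n s : (0 < n)%N -> (forall a, H a -> M (a ^+ n)) ->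
  (forall x, x \in s -> H x) ->
  finite_set [set left_coset x M | x in adjoin s].
Proof.
move=> n0 HnM; elim: s => [|h s IH] sHs.
  apply: sub_finite_set (finite_set1 (left_coset 1 M)).
  move=> _ [x [Mx _] <-]; rewrite -[x]mul1g.
  by rewrite left_comul_set //; exact: maximal_subgroupW.
have Hh : H h by apply: sHs; rewrite mem_head.
have sHs' x : x \in s -> H x by move=> xs; apply: sHs; rewrite in_cons xs orbT.
have [sP _ EP] := between_adjoins sHs'; case: (sP) => P1 PM PV.
have Phn : adjoin s (h ^+ n).
  by apply: EP; split; [exact: HnM|exact: subgroupX].
pose C k := [set [set h ^+ k * z | z in D] | D in [set left_coset x M |
  x in adjoin s]].
apply: (@sub_finite_set _ _ (\bigcup_(k in `I_n) C k)); last first.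
  by apply: bigcup_finite => // k _; apply: finite_image; exact: IH.
move=> _ [_ [_ [p [[i [j ->]] Pp ->]]] <-].
(* Congruent to [i - j] modulo [n], without a subtraction. *)
pose k := (i + n.-1 * j)%N.
have uE : h ^+ i * h ^- j = h ^+ (k %% n) * ((h ^+ n) ^+ (k %/ n) * (h ^+ n)
  ^- j).
  rewrite -!expgnA mulgA -expgnDr addnC (mulnC n (k %/ n)) -divn_eq.
  rewrite /k expgnDr -mulgA; congr (_ * _).
  rewrite -[in (n * j)%N](prednK n0) mulSn expgnDr.
  by rewrite !gnorm.
exists (k %% n)%N; first by rewrite /= ltn_mod.
exists (left_coset ((h ^+ n) ^+ (k %/ n) * (h ^+ n) ^- j * p) M).
  exists ((h ^+ n) ^+ (k %/ n) * (h ^+ n) ^- j * p) => //.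
  apply: (PM) => //; apply: (PM); first exact: subgroupX.
  by apply: PV; exact: subgroupX.
by rewrite -left_coset_mull uE !mulgA.
Qed.

(** Finitely many conjugates of some [h0] in [H] outside [M] already span an [M]-invariant subgroup
    modulo the intersection. By maximality it is all of [H], so the quotient is finitely generated;
    having finite exponent, it is finite. *)
Lemma finite_index_maximal : finite_index M G.
Proof.
have sM := maximal_subgroupW;
  case: (sM) (sH) (sG) => M1 MM MV [H1 HM HV] [G1 GM GV].
have [HsM|nHM] := pselect (H `<=` M); first exact: finite_index_sub fH.
have [//|GMH] := maximal_dichotomy maxM sG sH HG (fun g x Mg => nGH
  (maximal_sub Mg)).
have [h0 [Hh0 nMh0]] : exists h0, H h0 /\ ~ M h0.
  by apply: contra_notP nHM => nh x Hx; apply: contra_notP nh => nMx; exists x.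
have [s sGs Gs] := finite_indexP sH fH.
pose l := [seq x * h0 * x^-1 | x <- s].
have lH x : x \in l -> H x by case/mapP => y /sGs Gy ->; exact: nGH.
have bl := between_adjoins lH; case: (bl) => -[W1 WM WV] WH EW.
have nMl : normalised_by M (adjoin l).
  move=> m x Mm; move: x; have Gm := maximal_sub Mm.
  apply: adjoin_min; first by apply: subgroup_conj_preim; case: bl.
    move=> e [Me He] /=; apply: EW; split; last exact: nGH.
    exact: subgroupJ.
  move=> _ /mapP[x /sGs Gx ->] /=.
  (* With [y] representing the coset of [m * x], the conjugates of [h0] by [m * x] and by [y] differ
     by a commutator of [H]. *)
  have [y ys Ha] := Gs _ (GM _ _ Gm Gx); have Gy := sGs _ ys.
  pose a := y^-1 * (m * x); pose b := y * h0 * y^-1; pose c := y * a * y^-1.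
  have -> : m * (x * h0 * x^-1) * m^-1 = b * (b^-1 * c * b * c^-1).
    by rewrite /b /c /a !gnorm.
  have lb : b \in l by apply/mapP; exists y.
  have Hb := lH _ lb; have Hc : H c by exact: nGH.
  apply: (WM); first exact: mem_adjoin.
  by have := between_comm bl (HV _ Hb) Hc; rewrite invgK.
have [lM|Gl] := maximal_dichotomy maxM sG (let: And3 sl _ _ := bl in sl)
    (subset_trans WH HG) nMl.
  (* The representative [x] of the trivial coset lies in [H], so conjugating back by it puts [h0] in
     [M]. *)
  case: nMh0; have [x xs] := Gs _ G1; rewrite mulg1 => Hx.
  have lx : adjoin l (x * h0 * x^-1) by apply: mem_adjoin => //; apply/mapP;
    exists x.
  have Ex : (M `&` H) (x * h0 * x^-1) by split; [exact: lM|exact: WH].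
  by have [+ _] := between_normal between_setI Hx Ex; rewrite !gnorm.
have Hl : H `<=` adjoin l.
  move=> z Hz; have [m [w [Mm lw zE]]] := Gl _ (HG Hz).
  rewrite zE; apply: (WM) => //; apply: EW; split=> //.
  suff -> : m = z * w^-1 by apply: (HM) => //; exact/HV/WH.
  by rewrite zE !gnorm.
have [n n0 HnM] := exists_exponent lH Hl nHM.
apply: sub_finite_set (finite_cosets_adjoin n0 HnM lH).
(* Decomposing [g^-1] puts the factor from [M] on the right of [g]. *)
move=> _ [g Gg <-]; have [m [h [Mm Hh gE]]] := GMH _ (GV _ Gg).
exists h^-1; first exact/Hl/HV.
by rewrite -[g]invgK gE invgM left_comul_set //; exact: MV.
Qed.

End AbelianModuloMaximal.

End Groups.

(** * Paths from the root, levels, and agreement of automorphisms on subtrees *)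

Section Trees.
Variable T : rootedTree.
Implicit Types (u v w : T) (g h k : aut T) (n m : nat).

(** It omits [root] itself, so levels become lengths and the tree order becomes the prefix order. *)
Definition root_path w : seq T := projT1 (cid (tree_path root w)).

Lemma root_pathP w : simple_path adj root w (root_path w).
Proof. by rewrite /root_path; case: cid => p /= []. Qed.

Lemma root_path_unique w p : simple_path adj root w p -> root_path w = p.
Proof. by rewrite /root_path; case: cid => q /= [_ U] /U. Qed.

Lemma last_root_path w : last root (root_path w) = w.
Proof. by case: (root_pathP w) => -[]. Qed.

Lemma root_path_cat w p q :
  root_path w = p ++ q -> root_path (last root p) = p.
Proof.
case: (root_pathP w) => -[] + _ + E; rewrite E cat_path => /andP[ap _].
rewrite -cat_cons cat_uniq => /andP[up _].
by apply: root_path_unique.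
Qed.

Lemma belowE v w : below v w <-> prefix (root_path v) (root_path w).
Proof.
split=> [[p /root_path_unique <-]|/prefixP[q E]].
  rewrite in_cons => /predU1P[->|vp].
    by rewrite (_ : root_path root = [::]) ?prefix0s //;
      apply: root_path_unique.
  have [p1 [p2 E]] : exists p1 p2, root_path w = rcons p1 v ++ p2.
    by case/splitPr: vp => p1 p2; exists p1, p2; rewrite cat_rcons.
  by have := root_path_cat E; rewrite last_rcons E => ->; exact: prefix_prefix.
exists (root_path w); first exact: root_pathP.
by rewrite E -{1}(last_root_path v) -cat_cons mem_cat mem_last.
Qed.

(** Any path from the root shortens to a simple one, which is unique. *)
Lemma levelE n w : level T n w <-> size (root_path w) = n.
Proof.
have min p : path_between adj root w p -> size (root_path w) <= size p.
  move=> [ap <-]; case/shortenP: ap => p' ap' up' sp'.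
  rewrite (@root_path_unique _ p') //; apply: uniq_leq_size.
    by case/andP: up'.
  exact: sp'.
have [wP _] := root_pathP w.
split=> [[[p pP <-] minp]|<-]; last by split=> //; exists (root_path w).
by apply/eqP; rewrite eqn_leq minp // min.
Qed.

Lemma level_exists w : exists n, level T n w.
Proof. by exists (size (root_path w)); apply/levelE. Qed.

Lemma below_refl v : below v v.
Proof. exact/belowE/prefix_refl. Qed.

Lemma below_trans u v w : below u v -> below v w -> below u w.
Proof. by move=> /belowE uv /belowE vw; apply/belowE; exact: prefix_trans vw.
Qed.

Lemma below_level n m v w : level T n v -> level T m w -> below v w -> n <= m.
Proof. by move=> /levelE <- /levelE <- /belowE/size_prefix. Qed.

Lemma below_chain n m u v w : level T n u -> level T m v -> n <= m ->
  below u w -> below v w -> below u v.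
Proof.
move=> /levelE Lu /levelE Lv nm /belowE + /belowE; rewrite !prefixE Lu Lv.
move=> /eqP uE /eqP vE; apply/belowE; rewrite prefixE Lu -{1}vE.
by rewrite -take_min (minn_idPl nm) uE.
Qed.

Lemma ancestor_unique n u v w : level T n u -> level T n v ->
  below u w -> below v w -> u = v.
Proof.
move=> /levelE Lu /levelE Lv /belowE + /belowE; rewrite !prefixE Lu Lv.
move=> /eqP uE /eqP vE.
by rewrite -(last_root_path u) -(last_root_path v) -uE -vE.
Qed.

Lemma ancestor n m w : level T m w -> n <= m -> exists2 u,
  level T n u & below u w.
Proof.
move=> /levelE Lw nm; pose p := take n (root_path w).
have pE : root_path (last root p) = p.
  exact: (@root_path_cat w _ (drop n (root_path w))) (esym (cat_take_drop _ _)).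
exists (last root p); first by apply/levelE; rewrite pE size_take_min Lw;
  exact/minn_idPl.
by apply/belowE; rewrite pE prefix_take.
Qed.

Lemma root_path_aut g w : root_path (g w) = map g (root_path w).
Proof.
have [[aw lw] uw] := root_pathP w.
apply: root_path_unique; split; last first.
  rewrite -[X in X :: _](aut_root g) -map_cons map_inj_uniq //.
  exact: can_inj (aut_funK g).
split; last by rewrite -[X in last X](aut_root g) last_map lw.
rewrite -[X in path _ X](aut_root g) path_map.
by rewrite (@eq_path _ _ adj) // => x y /=; exact: aut_adj.
Qed.

Lemma level_aut g n w : level T n w -> level T n (g w).
Proof. by move=> /levelE Lw; apply/levelE; rewrite root_path_aut size_map. Qed.

Lemma below_aut g v w : below v w -> below (g v) (g w).
Proof.
move=> /belowE/prefixP[p E]; apply/belowE.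
by rewrite !root_path_aut E map_cat prefix_prefix.
Qed.

Lemma finite_level n : finite_set (level T n).
Proof.
elim: n => [|n IH].
  apply: sub_finite_set (finite_set1 root) => w /levelE/size0nil E.
  by rewrite -(last_root_path w) E.
apply: (@sub_finite_set _ _ (\bigcup_(v in level T n) neighbours adj v));
  last first.
  by apply: bigcup_finite => // v _; exact: tree_locally_finite.
move=> w Lw; have [v Lv] := ancestor Lw (leqnSn n).
move=> /belowE/prefixP[p E]; exists v => //.
move/levelE: Lw; move/levelE: Lv; rewrite E size_cat => ->.
rewrite -addn1 => /addnI; case: p E => [|x []] // E _.
have [[+ lw] _] := root_pathP w; rewrite E cat_path last_root_path /= andbT.
by rewrite -[in neighbours _ _ _]lw E last_cat => /andP[].
Qed.

Lemma aut_mulE g h w : (g * h) w = g (h w).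
Proof. by []. Qed.

Lemma aut_mulVE g : cancel g (g^-1)%g.
Proof. exact: aut_funK. Qed.

Lemma aut_mulEV g : cancel (g^-1)%g g.
Proof. exact: aut_invK. Qed.

Lemma aut_injective g : injective g.
Proof. exact: can_inj (aut_mulVE g). Qed.

Lemma aut_neq1 g : g <> 1 -> exists w, g w <> w.
Proof.
by apply: contra_notP => nw; apply: aut_inj => w; apply: contra_notP nw;
  exists w.
Qed.

(** For [g] and [h] fixing [u], this is equality of their coordinates at [u]. *)
Definition agree_below u g h := forall w, below u w -> g w = h w.

Lemma agree_refl u g : agree_below u g g. Proof. by []. Qed.

Lemma agree_sym u g h : agree_below u g h -> agree_below u h g.
Proof. by move=> gh w /gh. Qed.

Lemma agree_trans u g h k :
  agree_below u g h -> agree_below u h k -> agree_below u g k.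
Proof. by move=> gh hk w uw; rewrite gh ?hk. Qed.

Lemma agree_fix u g h : agree_below u g h -> g u = u -> h u = u.
Proof. by move=> gh gu; rewrite -gh ?gu //; exact: below_refl. Qed.

Lemma agreeM u g g' h h' : h u = u -> agree_below u g g' ->
  agree_below u h h' -> agree_below u (g * h) (g' * h').
Proof.
move=> hu gg hh w uw; rewrite !aut_mulE -hh // gg // -{1}hu; exact: below_aut.
Qed.

Lemma aut_fixV u g : g u = u -> g^-1 u = u.
Proof. by move=> gu; rewrite -{1}gu aut_mulVE. Qed.

Lemma agreeV u g h : g u = u -> agree_below u g h -> agree_below u g^-1 h^-1.
Proof.
move=> gu gh w uw; apply: (@aut_injective h);
  rewrite aut_mulEV -gh ?aut_mulEV //.
by rewrite -(aut_fixV gu); exact: below_aut.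
Qed.

Lemma agreeJ u g h k : agree_below u g h ->
  agree_below (k u) (k * g * k^-1) (k * h * k^-1).
Proof.
move=> gh w kuw; rewrite !aut_mulE gh // -[u](aut_mulVE k); exact: below_aut.
Qed.

Lemma agree_subgroup u : subgroup [set g | agree_below u g 1].
Proof.
have fu g : agree_below u g 1 -> g u = u by move/(_ u (below_refl u)).
split=> [|g h gu hu|g gu]; first exact: agree_refl.
  by move=> w uw; rewrite (agreeM (fu _ hu) gu hu).
by move=> w uw; rewrite (agreeV (fu _ gu) gu) // invg1.
Qed.

End Trees.

(** * Rigid stabilisers and the coordinates of elements of rigid level stabilisers *)

Section RigidStabilisers.
Variables (T : rootedTree) (G : set (aut T)).
Hypothesis sG : subgroup G.
Implicit Types (u v w : T) (g h x y : aut T) (n m : nat).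

Lemma rist_sub v : rist G v `<=` G. Proof. by move=> x []. Qed.

Lemma rist_subgroup v : subgroup (rist G v).
Proof.
case: sG => G1 GM GV; split=> [|x y [Gx xv] [Gy yv]|x [Gx xv]].
- by split.
- by split=> [|w vw]; [exact: GM|rewrite aut_mulE yv ?xv].
- by split=> [|w vw]; [exact: GV|rewrite -{1}(xv w vw) aut_mulVE].
Qed.

Lemma rist_neq1 v : rist G v <> [set 1] -> exists2 x, rist G v x & x <> 1.
Proof.
have [R1 _ _] := rist_subgroup v.
apply: contra_notP => nx; apply/seteqP; split=> [x Rx|_ -> //] /=.
by apply: contra_notP nx => x1; exists x.
Qed.

Lemma rist_conj g v x : G g -> rist G v x -> rist G (g v) (g * x * g^-1).
Proof.
move=> Gg [Gx xv]; split; first exact: subgroupJ.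
move=> w ngvw; rewrite !aut_mulE xv ?aut_mulEV // => vgw; apply: ngvw.
by rewrite -[w](aut_mulEV g); exact: below_aut.
Qed.

(** Otherwise [x u], having the level of [u], is not below [u]; then [x] fixes it, against
    injectivity. *)
Lemma rist_fix u x : rist G u x -> x u = u.
Proof.
move=> [_ xu]; have [n Lu] := level_exists u.
apply: contrapT => nxu; apply: (nxu); apply: (@aut_injective _ x);
  apply: xu => uxu.
by apply/nxu/esym;
  exact: ancestor_unique Lu (level_aut x Lu) uxu (below_refl _).
Qed.

Lemma rist_agree1 n u v x : level T n u -> level T n v -> u <> v ->
  rist G u x -> agree_below v x 1.
Proof.
move=> Lu Lv uv [_ xu] w vw; apply: xu => uw; apply: uv.
exact: ancestor_unique Lu Lv uw vw.
Qed.

Definition fixes_upto n : set (aut T) :=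
  [set g | forall k w, level T k w -> k <= n -> g w = w].

Lemma fixes_upto_subgroup n : subgroup (fixes_upto n).
Proof.
split=> [|g h gn hn|g gn] k w Lw kn //.
  by rewrite aut_mulE (hn k) ?(gn k).
exact/aut_fixV/(gn k).
Qed.

Lemma rist_fixes_upto n u x : level T n u -> rist G u x -> fixes_upto n x.
Proof.
move=> Lu Rx k w Lw kn; have [uw|nuw] := pselect (below u w);
  last by case: Rx => _ ->.
have kE : k = n by apply/eqP; rewrite eqn_leq kn (below_level Lu Lw uw).
rewrite kE in Lw.
by rewrite -(ancestor_unique Lu Lw uw (below_refl w)) (rist_fix Rx).
Qed.

Lemma rist_level_subgroup n : subgroup (rist_level G n).
Proof. exact: generated_subgroup. Qed.

Lemma sub_rist_level n u : level T n u -> rist G u `<=` rist_level G n.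
Proof. by move=> Lu x Rx; apply: sub_generated; exists u. Qed.

Lemma rist_level_min n K : subgroup K ->
  (forall u, level T n u -> rist G u `<=` K) -> rist_level G n `<=` K.
Proof. by move=> sK RK; apply: generated_min => // x [u Lu Rx]; exact: RK Rx.
Qed.

Lemma rist_level_sub n : rist_level G n `<=` G.
Proof. by apply: rist_level_min => // u _; exact: rist_sub. Qed.

Lemma rist_level_fixes_upto n : rist_level G n `<=` fixes_upto n.
Proof.
apply: rist_level_min; first exact: fixes_upto_subgroup.
by move=> u Lu x; exact: rist_fixes_upto.
Qed.

Lemma rist_level_fix n u g : level T n u -> rist_level G n g -> g u = u.
Proof. by move=> Lu Rg; apply: (rist_level_fixes_upto Rg) Lu _. Qed.

Lemma rist_level_normal n : normalised_by G (rist_level G n).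
Proof.
apply: generated_normalised => g x Gg [u Lu Rx].
by exists (g u); [exact: level_aut|exact: rist_conj].
Qed.

(** The elements with a coordinate at [u] form a subgroup; a generator from another vertex has
    coordinate [1]. *)
Lemma rist_level_coord n u g : level T n u -> rist_level G n g ->
  exists2 r, rist G u r & agree_below u g r.
Proof.
move=> Lu; pose K := [set g : aut T |
  g u = u /\ exists2 r, rist G u r & agree_below u g r].
have [R1 RM RV] := rist_subgroup u.
suff : rist_level G n `<=` K by move=> RK /RK[].
apply: rist_level_min; first split.
- by split=> //; exists 1.
- move=> x y [xu [r Rr xr]] [yu [s Rs ys]].
  split; first by rewrite aut_mulE yu.
  by exists (r * s); [exact: RM|exact: agreeM].
- move=> x [xu [r Rr xr]]; split; first exact: aut_fixV.
  by exists r^-1; [exact: RV|exact: agreeV].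
- move=> v Lv x Rx; have [vu|vu] := pselect (v = u).
    rewrite vu in Rx; split; first exact: rist_fix Rx.
    by exists x.
  have x1 := rist_agree1 Lv Lu vu Rx.
  split; first by apply: x1; exact: below_refl.
  by exists 1.
Qed.

Lemma eq_agree n g h : fixes_upto n g -> fixes_upto n h ->
  (forall u, level T n u -> agree_below u g h) -> g = h.
Proof.
move=> gn hn gh; apply: aut_inj => w; have [k Lw] := level_exists w.
have [kn|/ltnW nk] := leqP k n; first by rewrite (gn k) ?(hn k).
by have [u Lu uw] := ancestor Lw nk; exact: gh Lu _ uw.
Qed.

(* An element of [rist_level G n] is the product of its coordinates. *)
Lemma rist_level_mem n K g : subgroup K -> rist_level G n g ->
  (forall u r, level T n u -> rist G u r -> agree_below u g r -> K r) -> K g.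
Proof.
move=> [K1 KM KV] Rg Kg; have [R1 RM _] := rist_level_subgroup n.
have /finite_seqP[s Es] := finite_level T n.
suff [k [Kk Rk gk _]] : exists k, [/\ K k, rist_level G n k,
    forall u, u \in s -> agree_below u g k &
    forall u, level T n u -> u \notin s -> agree_below u k 1].
  suff -> : g = k by [].
  apply: (@eq_agree n); do ?exact: rist_level_fixes_upto.
  by move=> u; rewrite Es; exact: gk.
have : {subset s <= s} by [].
(* For a sublist [l] of the level, [k] is the product of the coordinates of [g] at the vertices of
   [l], repetitions being skipped. *)
elim: {1 3 4}s => [|v l IH] sl; first by exists 1; split.
have [|k [Kk Rk gk k1]] := IH.
  by move=> u ul; apply: sl; rewrite in_cons ul orbT.
have Lv : level T n v by rewrite Es; apply: sl; exact: mem_head.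
have [vl|nvl] := boolP (v \in l).
  exists k; split=> // u; first by case/predU1P => [->|]; exact: gk.
  by move=> Lu; rewrite in_cons negb_or => /andP[_]; exact: k1.
have [r Rr gr] := rist_level_coord Lv Rg.
have ru u : level T n u -> r u = u by move=> Lu;
  exact: rist_fixes_upto Lv Rr _ _ Lu _.
have r1 u : level T n u -> u <> v -> agree_below u r 1.
  by move=> Lu uv; apply: rist_agree1 Lv Lu _ Rr => vu; exact: uv.
exists (k * r); split.
- by apply: KM => //; exact: Kg Rr gr.
- by apply: RM => //; exact: sub_rist_level Rr.
- move=> u ul; have Lu : level T n u by rewrite Es; exact: sl.
  move: ul; rewrite in_cons; have [-> _|uv /= ul] := eqVneq u v.
    rewrite -[g]mul1g.
    apply: agreeM; [exact: rist_level_fix Lv Rg|exact/agree_sym/k1|exact: gr].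
  rewrite -[g]mulg1; apply: agreeM => //; first exact: gk.
  by apply/agree_sym/r1 => //; exact/eqP.
- move=> u Lu; rewrite in_cons negb_or => /andP[/eqP uv nul].
  by rewrite -[X in agree_below _ _ X]mulg1; apply: agreeM;
    [exact: ru|exact: k1|exact: r1].
Qed.

Lemma rist_subset u v : below v u -> rist G u `<=` rist G v.
Proof.
move=> vu x [Gx xu]; split=> // w nvw; apply: xu => uw; apply: nvw.
exact: below_trans uw.
Qed.

Lemma rist_level_subset n m : n <= m -> rist_level G m `<=` rist_level G n.
Proof.
move=> nm; apply: rist_level_min; first exact: rist_level_subgroup.
move=> u Lu; have [v Lv vu] := ancestor Lu nm.
by apply: subset_trans (sub_rist_level Lv); exact: rist_subset.
Qed.

End RigidStabilisers.

(** * Commutation with rigid stabilisers, and consequences of their nontriviality *)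

Section NontrivialRigidStabilisers.
Variables (T : rootedTree) (G : set (aut T)).
Hypothesis sG : subgroup G.
Implicit Types (u v w : T) (g h x y r : aut T) (n m : nat).

(** The supports of [g] and [x] are disjoint. *)
Lemma rist_commute u x g : rist G u x -> agree_below u g 1 -> commute g x.
Proof.
move=> Rx gu; have xuu := rist_fix Rx; have guu := gu _ (below_refl u).
case: (Rx) => _ xu; apply: aut_inj => w; rewrite !aut_mulE.
have [uw|nuw] := pselect (below u w).
  by rewrite (gu w) // gu // -{1}xuu; exact: below_aut.
rewrite (xu w nuw) xu // => ugw; apply: nuw.
by rewrite -[w](aut_mulVE g) -(aut_fixV guu); exact: below_aut.
Qed.

Lemma rist_agree_eq u x y : rist G u x -> rist G u y -> agree_below u x y ->
  x = y.
Proof.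
move=> [_ xu] [_ yu] xy; apply: aut_inj => w.
by have [/xy //|nuw] := pselect (below u w); rewrite xu ?yu.
Qed.

(** [h^-1 * g] is trivial below [u], so it commutes with [x]. *)
Lemma rist_agree_conj u x g h : rist G u x -> g u = u ->
  agree_below u g h -> g * x * g^-1 = h * x * h^-1.
Proof.
move=> Rx gu gh; have hu := agree_fix gh gu.
have /(rist_commute Rx) C : agree_below u (h^-1 * g) 1.
  by rewrite -(mulVg h); apply: agreeM gu _ gh.
have : h * (h^-1 * g * x) * g^-1 = h * (x * (h^-1 * g)) * g^-1 by rewrite C.
by rewrite !gnorm.
Qed.

Hypothesis ntG : forall v, rist G v <> [set 1].

Lemma rist_moves v : exists x w, [/\ rist G v x, below v w & x w <> w].
Proof.
have [x Rx /aut_neq1[w xw]] := rist_neq1 sG (@ntG v).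
exists x, w; split=> //; apply: contrapT => nvw; apply: xw.
by case: Rx => _ ->.
Qed.

(** A nontrivial element of [rist G w] fixes all levels up to that of [w], so it moves a strictly
    deeper vertex below [w]; this is iterated. *)
Lemma exists_below_level n m v : level T n v -> n <= m ->
  exists2 u, level T m u & below v u.
Proof.
move=> Lv nm.
suff [w [k [vw Lw mk]]] : exists w k, [/\ below v w, level T k w & m <= k].
  have [u Lu uw] := ancestor Lw mk.
  by exists u => //; exact: below_chain Lv Lu nm vw uw.
elim: m {nm} => [|m [w [k [vw Lw mk]]]]; first by exists v, n; split=> //;
  exact: below_refl.
have [x [z [Rx wz xz]]] := rist_moves w; have [j Lz] := level_exists z.
exists z, j; split=> //; first exact: below_trans wz.
apply: leq_ltn_trans mk _; rewrite ltnNge; apply/negP => jk.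
by apply: xz; exact: rist_fixes_upto Lw Rx _ _ Lz jk.
Qed.

(** Here [x] moves some [w] below [u] and [y] is nontrivial in [rist G w]: conjugation by [x]
    carries the support of [y] off itself. *)
Lemma rist_not_commutative u : exists x y, [/\ rist G u x,
  rist G u y & ~ commute x y].
Proof.
have [x [w [Rx uw xw]]] := rist_moves u.
have [y Ry y1] := rist_neq1 sG (@ntG w); have [n Lw] := level_exists w.
exists x, y; split=> //; first exact: rist_subset Ry.
move=> C; apply: y1.
have Gx : G x by case: Rx.
have Ry' : rist G (x w) y.
  by have := rist_conj sG Gx Ry; rewrite C mulgK.
have [R1 _ _] := rist_subgroup sG w.
apply: (rist_agree_eq Ry R1).
exact: rist_agree1 (level_aut x Lw) Lw xw Ry'.
Qed.

End NontrivialRigidStabilisers.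

(** * Maximal subgroups of infinite index against normal subgroups of [G] *)

Section MaximalSubgroup.
Variables (T : rootedTree) (G M : set (aut T)).
Hypotheses (bG : branch_group G) (maxM : maximal_subgroup M G).
Hypothesis infM : ~ finite_index M G.
Implicit Types (u v w : T) (g h x y r : aut T) (n m : nat) (X N : set (aut T)).

Let sG : subgroup G. Proof. by case: bG. Qed.
Let trG : level_transitive G. Proof. by case: bG. Qed.
Let ntG v : rist G v <> [set 1]. Proof. by case: bG. Qed.
Let fG n : finite_index (rist_level G n) G. Proof. by case: bG. Qed.
Let sM : subgroup M. Proof. by case: maxM. Qed.
Let MG : M `<=` G. Proof. by case: maxM => _ []. Qed.

(** The conjugate [z] of [x] by [g] is supported below [g u], away from [u]. So [z^-1 * x], which
    lies in [N], has the same commutator with [y] as [x] has. *)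
Lemma normal_commutator N g u n x y : subgroup N -> normalised_by G N ->
  N g -> G g -> level T n u -> g u <> u -> rist G u x -> rist G u y ->
  N (x * y * x^-1 * y^-1).
Proof.
move=> [N1 NM NV] nN Ng Gg Lu gu Rx Ry.
have [_ GM GV] := sG; have [_ RM RV] := rist_subgroup sG u.
have Gx := rist_sub Rx; have Gy := rist_sub Ry.
pose z := g * x * g^-1.
have Rz : rist G (g u) z by exact: rist_conj.
have zu : agree_below u z^-1 1.
  have [_ _ RVz] := rist_subgroup sG (g u).
  exact: rist_agree1 (level_aut g Lu) Lu gu (RVz _ Rz).
have Na : N (z^-1 * x).
  have := NM _ _ Ng (nN _ _ (GV _ Gx) (NV _ Ng)).
  by rewrite /z !gnorm.
have Nb : N (z^-1 * x * (y * (z^-1 * x)^-1 * y^-1)).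
  by apply: (NM) => //; apply: nN => //; exact: NV.
suff <- : z^-1 * x * (y * (z^-1 * x)^-1 * y^-1) = x * y * x^-1 * y^-1 by [].
have C := rist_commute (subgroupJ (rist_subgroup sG u) Rx Ry) zu.
have : z^-1 * (x * y * x^-1) * z * y^-1 = x * y * x^-1 * z^-1 * z * y^-1
  by rewrite C.
by rewrite !gnorm.
Qed.

(* A nontrivial normal subgroup contains the derived subgroup of some
   [rist_level G n], so its quotient is virtually abelian. *)
Lemma maximal_core_free N : subgroup N -> N `<=` M -> normalised_by G N ->
  forall g, N g -> g = 1.
Proof.
move=> sN NM nN g Ng; apply: contrapT => /aut_neq1[u gu]; apply: infM.
have [n Lu] := level_exists u; have Gg := MG (NM _ Ng).
have [_ GM GV] := sG.
apply: (@finite_index_maximal _ G (rist_level G n) M) => //.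
- exact: rist_level_subgroup.
- exact: rist_level_sub.
- exact: rist_level_normal.
move=> a b Ra Rb; apply: NM; have [_ RM RV] := rist_level_subgroup G n.
apply: (@rist_level_mem _ _ sG n) => //.
  exact: subgroupR (rist_level_subgroup G n) Ra Rb.
move=> v r Lv Rr abr.
have [x Rx ax] := rist_level_coord sG Lv Ra.
have [y Ry bY] := rist_level_coord sG Lv Rb.
have [_ SM SV] := rist_subgroup sG v.
have xv := rist_fix Rx; have yv := rist_fix Ry.
have av := rist_level_fix Lv Ra; have bv := rist_level_fix Lv Rb.
have -> : r = x * y * x^-1 * y^-1.
  apply: (rist_agree_eq Rr); first exact: subgroupR (rist_subgroup sG v) Rx Ry.
  apply: (agree_trans (agree_sym abr)).
  have av' := aut_fixV av; have bv' := aut_fixV bv.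
  apply: agreeM => //; last exact: agreeV.
  apply: agreeM => //; last exact: agreeV.
  exact: agreeM.
(* The commutators known to lie in [N] are those at [u]; transitivity and normality carry them to
   [v]. *)
have [k Gk kuv] := trG Lu Lv.
have Rk z : rist G v z -> rist G u (k^-1 * z * k).
  by move=> /(rist_conj sG (GV _ Gk)); rewrite -kuv aut_mulVE invgK.
have := nN _ _ Gk (normal_commutator sN nN Ng Gg Lu gu (Rk _ Rx) (Rk _ Ry)).
by rewrite !gnorm.
Qed.

Lemma maximal_prodense N x : subgroup N -> N `<=` G -> normalised_by G N ->
  N x -> x <> 1 -> G `<=` mul_set M N.
Proof.
move=> sN NG nN Nx x1.
have nMN : normalised_by M N by move=> g y /MG; exact: nN.
have [NM|//] := maximal_dichotomy maxM sG sN NG nMN.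
by case: x1; exact: maximal_core_free Nx.
Qed.

Lemma prodense_rist_level n u : level T n u ->
  G `<=` mul_set M (rist_level G n).
Proof.
move=> Lu; have [x Rx x1] := rist_neq1 sG (@ntG u).
apply: maximal_prodense x1;
  [exact: rist_level_subgroup|exact: rist_level_sub|exact: rist_level_normal|].
exact: sub_rist_level Rx.
Qed.

(** The factor from the rigid level stabiliser fixes the level pointwise. *)
Lemma maximal_level_transitive : level_transitive M.
Proof.
move=> n v w Lv Lw; have [g Gg gv] := trG Lv Lw.
have [s [t [Ms Rt gE]]] := prodense_rist_level Lv Gg.
by exists s => //; rewrite -gv gE aut_mulE (rist_level_fix Lv Rt).
Qed.

(** * Coordinates of the elements of [M] in a rigid level stabiliser, and minimal supports *)

Section Level.
Variable m : nat.
Notation D := (M `&` rist_level G m).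

(** For a subgroup [X] of [D], the product of its projections to the rigid stabilisers of level
    [m]. *)
Definition coordwise X : set (aut T) := [set g | rist_level G m g /\
  forall u, level T m u -> exists2 d, X d & agree_below u g d].

Lemma level_part_subgroup : subgroup D.
Proof. by apply: subgroup_setI => //; exact: rist_level_subgroup. Qed.

Lemma level_part_normal : normalised_by M D.
Proof.
move=> g x Mg [Mx Rx]; split; first exact: subgroupJ.
by apply: rist_level_normal => //; exact: MG.
Qed.

Lemma level_part_fix u d : level T m u -> D d -> d u = u.
Proof. by move=> Lu [_]; exact: rist_level_fix. Qed.

Lemma coordwise_sub X : X `<=` D -> X `<=` coordwise X.
Proof. by move=> XD d Xd; split=> [|u _]; [case: (XD _ Xd)|exists d]. Qed.

Lemma coordwise_subgroup X : subgroup X -> X `<=` D -> subgroup (coordwise X).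
Proof.
move=> [X1 XM XV] XD; have [R1 RM RV] := rist_level_subgroup G m.
split=> [|g h [Rg gX] [Rh hX]|g [Rg gX]].
- by split=> // u _; exists 1.
- split=> [|u Lu]; first exact: RM.
  have [d Xd gd] := gX _ Lu; have [e Xe he] := hX _ Lu.
  exists (d * e); first exact: XM.
  by apply: agreeM => //; exact: rist_level_fix Rh.
- split=> [|u Lu]; first exact: RV.
  have [d Xd gd] := gX _ Lu; exists d^-1; first exact: XV.
  by apply: agreeV => //; exact: rist_level_fix Rg.
Qed.

Lemma coordwise_normal X : normalised_by M X -> normalised_by M (coordwise X).
Proof.
move=> nX s g Ms [Rg gX]; split; first by apply: rist_level_normal => //;
  exact: MG.
move=> u Lu; have [d Xd gd] := gX _ (level_aut s^-1 Lu).
exists (s * d * s^-1); first exact: nX.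
by have := agreeJ (k := s) gd; rewrite aut_mulEV.
Qed.

Definition subdirect := forall u r, level T m u -> rist G u r ->
  exists2 d, D d & agree_below u r d.

(** This is [maximal_dichotomy] for [coordwise D], which [M] normalises. *)
Lemma rist_level_or_subdirect : D `<=` rist_level M m \/ subdirect.
Proof.
have sD := level_part_subgroup;
  have sC := coordwise_subgroup sD (@subset_refl _ _).
have CG : coordwise D `<=` G by move=> g [/(rist_level_sub sG)].
have [CM|GC] := maximal_dichotomy maxM sG sC CG (coordwise_normal
  level_part_normal).
  left=> d [Md Rd]; apply: (rist_level_mem sG (rist_level_subgroup M m) Rd).
  (* The coordinate [r] of [d] lies in [coordwise D], its own other coordinates being [1]. *)
  move=> u r Lu Rr dr; apply: (sub_rist_level Lu).
  split; last by case: Rr.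
  apply: CM; split; first exact: sub_rist_level Rr.
  move=> v Lv; have [vu|uv] := pselect (v = u).
    by exists d => //; rewrite vu; exact: agree_sym.
  exists 1; first by case: sD.
  by apply: rist_agree1 Lu Lv _ Rr => uv'; exact: uv.
right=> u r Lu Rr.
have [s [t [Ms [Rt tD] rE]]] := GC _ (rist_sub Rr).
have [_ RM RV] := rist_level_subgroup G m; have [_ DM _] := sD.
have Ds : D s.
  split=> //; suff -> : s = r * t^-1 by apply: (RM);
    [exact: sub_rist_level Rr|exact: RV].
  by rewrite rE !gnorm.
have [d Dd td] := tD _ Lu; exists (s * d); first exact: DM.
by rewrite rE; apply: agreeM => //; exact: rist_level_fix Lu Rt.
Qed.

Hypothesis sdD : subdirect.

Lemma subdirect_rist_level u g : level T m u -> rist_level G m g ->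
  exists2 d, D d & agree_below u g d.
Proof.
move=> Lu Rg; have [r Rr gr] := rist_level_coord sG Lu Rg.
by have [d Dd rd] := sdD Lu Rr; exists d => //; exact: agree_trans gr rd.
Qed.

(* A rigid stabiliser has no nontrivial abelian normal subgroup. *)
Lemma agree1_of_commuting_conjugates a u : rist_level G m a -> level T m u ->
  (forall h, D h -> agree_below u (a * (h * a * h^-1)) (h * a * h^-1 * a)) ->
  agree_below u a 1.
Proof.
move=> Ra Lu aC; have [r Rr ar] := rist_level_coord sG Lu Ra.
have [_ RM RV] := rist_subgroup sG u.
(* By subdirectness [y] acts below [u] as an element of [D]. So the normal closure of [r] in
   [rist G u] is abelian. *)
have rC y : rist G u y -> commute r (y * r * y^-1).
  move=> Ry; have [h Dh yh] := sdD Lu Ry.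
  have Ryr : rist G u (y * r * y^-1)
    by exact: subgroupJ (rist_subgroup sG u) Ry Rr.
  have yu := rist_fix Ry; have ru := rist_fix Rr.
  have au := rist_level_fix Lu Ra.
  have hu := level_part_fix Lu Dh.
  have k : agree_below u (h * a * h^-1) (y * r * y^-1).
    apply: agreeM; [exact: aut_fixV| |by apply: agreeV => //; exact: agree_sym].
    by apply: agreeM => //; exact: agree_sym.
  have ku : (h * a * h^-1) u = u by rewrite !aut_mulE aut_fixV ?au.
  apply: (rist_agree_eq (RM _ _ Rr Ryr) (RM _ _ Ryr Rr)).
  apply: (@agree_trans _ u _ (a * (h * a * h^-1))); first by apply/agree_sym;
    exact: agreeM.
  by apply: agree_trans (aC _ Dh) _; exact: agreeM.
apply: agree_trans ar _; suff -> : r = 1 by [].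
apply: contrapT => /aut_neq1[z rz].
have uz : below u z by apply: contrapT => nuz; apply: rz; case: Rr => _ ->.
have [x [y [Rx Ry]]] := rist_not_commutative sG (@ntG) z; apply.
have Gr := rist_sub Rr; have [_ GM GV] := sG; have Gr' := GV _ Gr.
have [n Lz] := level_exists z.
have sRz := rist_subgroup sG z; have [_ RzM RzV] := sRz.
(* As [r] moves [z], the support of [r^-1 * k * r] avoids the subtree of [z]. The left-hand sides
   commute for any two [k], so [x^-1] and [y^-1] will commute. *)
have kz k : rist G z k -> agree_below z (r^-1 * (k * r * k^-1)) k^-1.
  move=> Rk; have := rist_conj sG Gr' Rk; rewrite invgK => Rk'.
  have rz' : r^-1 z <> z by move=> rzE; apply: rz; rewrite -{1}rzE aut_mulEV.
  have := rist_agree1 (level_aut r^-1 Lz) Lz rz' Rk'.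
  have kfz := rist_fix (RzV _ Rk).
  by move/(agreeM kfz)/(_ (@agree_refl _ z k^-1)); rewrite !gnorm.
have uk k : rist G z k -> rist G u k by exact: rist_subset.
pose c k := k * r * k^-1.
have cC : commute (c x) (c y).
  have := rC _ (uk _ (RzM _ _ (RzV _ Rx) Ry)).
  move=> C; have : x * (r * (x^-1 * y * r * (x^-1 * y)^-1)) * x^-1 =
    x * (x^-1 * y * r * (x^-1 * y)^-1 * r) * x^-1 by rewrite C.
  by rewrite /commute /c !gnorm.
have rcC k : rist G z k -> commute r^-1 (c k).
  by move=> Rk; apply/commute_sym/commuteV/commute_sym/rC/uk.
have kC : commute (r^-1 * c x) (r^-1 * c y).
  apply: commuteM; apply/commute_sym/commuteM.
  - exact: commute_refl.
  - exact: rcC.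
  - exact/commute_sym/rcC.
  - exact/commute_sym.
have czf k : rist G z k -> (r^-1 * c k) z = z.
  by move=> Rk; have /agree_sym/agree_fix := kz _ Rk; apply;
    exact: rist_fix (RzV _ Rk).
have xyV : x^-1 * y^-1 = y^-1 * x^-1.
  apply: (rist_agree_eq (RzM _ _ (RzV _ Rx) (RzV _ Ry)) (RzM _ _ (RzV _ Ry)
    (RzV _ Rx))).
  apply: (@agree_trans _ z _ (r^-1 * c x * (r^-1 * c y))).
    by apply/agree_sym/agreeM; [exact: czf|exact: kz|exact: kz].
  by rewrite kC; apply: agreeM; [exact: czf|exact: kz|exact: kz].
by apply: invg_inj; rewrite !invgM.
Qed.

(* The support of [d] consists of the [u] of level [m] with [d] nontrivial below
   [u]; the last two hypotheses on [e] make its support strictly smaller. *)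
Definition minimal_support : set (aut T) := [set d | D d /\ forall e, D e ->
  (forall u, level T m u -> agree_below u d 1 -> agree_below u e 1) ->
  (exists u, [/\ level T m u, agree_below u e 1 & ~ agree_below u d 1]) ->
  e = 1].

Notation Min := minimal_support.

(** The vertices are treated in turn: [e] is replaced, if possible, by a nontrivial element of [D]
    of no larger support that is trivial at [v]. Supports only shrink, so minimality at earlier
    vertices persists. *)
Lemma exists_minimal_support d : D d -> d <> 1 -> exists2 e, Min e & e <> 1.
Proof.
move=> Dd d1; have /finite_seqP[s Es] := finite_level T m.
suff [e [De e1 emin]] : exists e, [/\ D e, e <> 1 & forall u k, u \in s ->
    D k -> k <> 1 ->
    (forall v, level T m v -> agree_below v e 1 -> agree_below v k 1) ->
    agree_below u k 1 -> agree_below u e 1].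
  exists e => //; split=> // k Dk ek [u [Lu ku neu]].
  apply: contrapT => k1; apply: neu; apply: emin ek ku => //.
  by have : [set` s] u by rewrite -Es.
have sL u : u \in s -> level T m u by rewrite Es.
elim: s {Es} sL => [|v s IH] sL; first by exists d.
have [|e [De e1 emin]] := IH; first by move=> u us; apply: sL;
  rewrite in_cons us orbT.
have [[k [Dk k1 ek kv]]|nk] := pselect (exists k, [/\ D k, k <> 1,
    forall w, level T m w -> agree_below w e 1 -> agree_below w k 1 &
    agree_below v k 1]).
  exists k; split=> // u l; rewrite in_cons => /predU1P[-> //|us] Dl l1 kl lu.
  apply: (ek); first by apply: sL; rewrite in_cons us orbT.
  by apply: emin lu => // w Lw ew; exact/kl/ek.
exists e; split=> // u l; rewrite in_cons => /predU1P[->|us] Dl l1 el lu.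
  by case: nk; exists l.
exact: emin lu.
Qed.

(** The support of the commutator lies in that of [e] and misses [u], so minimality of [e] makes it
    trivial. *)
Lemma minimal_support_commute d e u : Min d -> Min e -> level T m u ->
  agree_below u d 1 -> ~ agree_below u e 1 -> commute d e.
Proof.
move=> [Dd _] [De emin] Lu du eu.
suff : d * e * d^-1 * e^-1 = 1.
  by move/(congr1 (fun x => x * e * d)); rewrite !gnorm.
apply: emin; first exact: subgroupR level_part_subgroup Dd De.
  move=> v Lv ev; have dv := level_part_fix Lv Dd; have dv' := aut_fixV dv.
  have ev' := aut_fixV (level_part_fix Lv De).
  have -> : 1 = d * 1 * d^-1 * 1^-1 :> aut T by rewrite !gnorm.
  apply: agreeM => //; last by apply: agreeV => //; exact: level_part_fix De.
  by apply: agreeM => //; apply: agreeM => //; exact: level_part_fix De.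
exists u; split=> //.
have -> : 1 = 1 * e * 1^-1 * e^-1 :> aut T by rewrite !gnorm.
have duu := level_part_fix Lu Dd; have euu := level_part_fix Lu De.
have du' := aut_fixV duu; have eu' := aut_fixV euu.
by apply: agreeM => //; apply: agreeM => //; [exact: agreeM|exact: agreeV].
Qed.

Lemma agree1J (s : aut T) u g : agree_below (s u) (s * g * s^-1) 1 <->
  agree_below u g 1.
Proof.
have H (k : aut T) v x : agree_below v x 1 ->
  agree_below (k v) (k * x * k^-1) 1.
  by move/(agreeJ (k := k)); rewrite !gnorm.
split; last exact: H.
by move/(H s^-1); rewrite aut_mulVE !gnorm.
Qed.

Lemma minimal_support_normal : normalised_by M Min.
Proof.
move=> s d Ms [Dd dmin]; have [_ MM MV] := sM; split;
  first exact: level_part_normal.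
move=> e De de [u [Lu eu du]].
have De' : D (s^-1 * e * s) by have := level_part_normal (MV _ Ms) De;
  rewrite invgK.
suff : s^-1 * e * s = 1.
  by move/(congr1 (fun x => s * x * s^-1)); rewrite !gnorm.
apply: dmin => //.
  move=> v Lv /(agree1J s)/(de _ (level_aut s Lv)) ev.
  by apply/(agree1J s); rewrite !gnorm.
exists (s^-1 u); split; first exact: level_aut.
  by apply/(agree1J s); rewrite aut_mulEV !gnorm.
by move/(agree1J s); rewrite aut_mulEV.
Qed.

Lemma minimal_support_sub : Min `<=` D. Proof. by move=> d []. Qed.

Lemma generated_sub_level_part X : X `<=` Min -> generated X `<=` D.
Proof.
move=> XMin; apply: generated_min; first exact: level_part_subgroup.
exact: subset_trans XMin minimal_support_sub.
Qed.

Lemma minimal_support_level_normal : normalised_by D Min.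
Proof. by move=> h d [Mh _]; exact: minimal_support_normal. Qed.

(* Otherwise [d] would commute, on the coordinate [u], with all its
   conjugates. *)
Lemma minimal_support_commute_fix c d u : M c -> Min d -> level T m u ->
  agree_below u c 1 -> ~ agree_below u d 1 -> commute c d.
Proof.
move=> Mc Md Lu cu ndu; have [Dd dmin] := Md.
have cuu : c u = u by exact: (cu _ (below_refl u)).
pose d' := c * d * c^-1.
have Md' : Min d' by exact: minimal_support_normal.
have [Dd' _] := Md'.
have d'd : agree_below u d' d.
  have -> : d = 1 * d * 1^-1 by rewrite !gnorm.
  have du := level_part_fix Lu Dd; have cu' := aut_fixV cuu.
  by apply: agreeM => //; [apply: agreeM|apply: agreeV].
suff : d' * d^-1 = 1.
  by move/(congr1 (fun x => x * d * c)); rewrite /d' /commute !gnorm.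
have sD := level_part_subgroup; have [_ DM DV] := sD.
(* If the support of [d'] lies in that of [d], then [d' * d^-1] has smaller support than [d], since
   it vanishes at [u]. *)
have [dd'|] := pselect (forall v,
  level T m v -> agree_below v d 1 -> agree_below v d' 1).
  apply: dmin; first by apply: DM => //; exact: DV.
    move=> v Lv dv; have -> : 1 = 1 * 1^-1 :> aut T by rewrite !gnorm.
    have vv := level_part_fix Lv Dd; have vv' := aut_fixV vv.
    by apply: agreeM => //; [exact: dd'|exact: agreeV].
  exists u; split=> //; rewrite -(mulgV d).
  by apply: agreeM => //; exact/aut_fixV/level_part_fix.
(* Otherwise some [v] is in the support of [d'] only. Conjugates of [d] under [D] are trivial at
   [v], hence commute with [d'], which agrees with [d] below [u]. *)
move=> /existsNP[v /not_implyP[Lv /not_implyP[dv nd'v]]].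
case: ndu; apply: agree1_of_commuting_conjugates => //; first by case: Dd.
move=> h Dh; pose k := h * d * h^-1.
have Mk : Min k by exact: minimal_support_level_normal.
have kv : agree_below v k 1.
  by have /(agree1J h) := dv; rewrite (level_part_fix Lv Dh).
have C := minimal_support_commute Mk Md' Lv kv nd'v.
have [Dk _] := Mk; have ku := level_part_fix Lu Dk.
apply: (@agree_trans _ u _ (d' * k)); first by apply/agree_sym; exact: agreeM.
rewrite -C; apply: agreeM => //; exact: level_part_fix Dd'.
Qed.

Lemma generated_commute X x :
  (forall y, X y -> commute x y) -> forall y, generated X y -> commute x y.
Proof.
move=> XC; apply: generated_min => //; split=> [|y z|y].
- exact: commute1.
- exact: commuteM.
- exact: commuteV.
Qed.

(** The vertex [u0] guarantees [c <> 1]: [c] is [x] times an element fixing level [m], so it moves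
    [u0]. *)
Lemma exists_rist v n x u0 : level T n v -> n <= m -> rist G v x ->
  level T m u0 -> x u0 <> u0 -> exists2 c, rist M v c & c <> 1.
Proof.
move=> Lv nm Rx Lu0 xu0; have [_ MM MV] := sM.
have sD := level_part_subgroup; have [_ DM DV] := sD.
pose B := generated Min; have sB : subgroup B by exact: generated_subgroup.
have BD : B `<=` D by exact: generated_sub_level_part.
have nB : normalised_by M B
  by exact: generated_normalised minimal_support_normal.
pose C := coordwise B; have sC : subgroup C by exact: coordwise_subgroup.
have [_ CM CV] := sC.
have BC : B `<=` C by exact: coordwise_sub.
have CR : C `<=` rist_level G m by move=> g [].
have nC : normalised_by G C.
  (* On each coordinate [t] acts as an element of [D], which normalises [B]. *)
  move=> g b Gg Cb; have [s [t [Ms Rt ->]]] := prodense_rist_level Lu0 Gg.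
  suff Ct : C (t * b * t^-1).
    by have := coordwise_normal nB Ms Ct; rewrite !gnorm.
  split; first exact: subgroupJ (rist_level_subgroup G m) Rt (CR _ Cb).
  move=> u Lu; have [d Dd td] := subdirect_rist_level Lu Rt.
  have [_ /(_ u Lu)[e Be be]] := Cb.
  exists (d * e * d^-1); first by apply: nB => //; case: Dd.
  have tu := rist_level_fix Lu Rt; have tu' := aut_fixV tu.
  have bu := rist_level_fix Lu (CR _ Cb).
  by apply: agreeM => //; [exact: agreeM|exact: agreeV].
have [b Cb b1] : exists2 b, C b & b <> 1.
  have [r Rr r1] := rist_neq1 sG (@ntG u0).
  have [d Dd rd] := sdD Lu0 Rr.
  have d1 : d <> 1.
    move=> dE; apply: r1; have [R1 _ _] := rist_subgroup sG u0.
    by apply: (rist_agree_eq Rr R1); rewrite -dE.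
  have [e Me e1] := exists_minimal_support Dd d1.
  by exists e => //; apply: BC; exact: sub_generated.
have GMC := maximal_prodense sC (subset_trans CR (@rist_level_sub _ _ sG m))
  nC Cb b1.
have xfix u : level T m u -> ~ below v u -> agree_below u x 1.
  move=> Lu nvu z uz; case: Rx => _; apply => vz; apply: nvu.
  exact: below_chain Lv Lu nm vz uz.
(* The list [s] holds the coordinates treated so far. *)
have key (s : seq T) : (forall u, u \in s -> level T m u) -> exists c t,
  [/\ M c, C t,
    c = x * t & forall u, u \in s -> ~ below v u -> agree_below u c 1].
  elim: s => [|w s IH] Ls.
    have [c [t [Mc Ct xE]]] := GMC _ (rist_sub Rx).
    exists c, t^-1; split=> //; first exact: CV.
    by rewrite xE !gnorm.
  have [|c [t [Mc Ct cE cs]]] := IH.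
    by move=> u us; apply: Ls; rewrite in_cons us orbT.
  have Lw : level T m w by apply: Ls; exact: mem_head.
  have [vw|nvw] := pselect (below v w).
    by exists c, t; split=> // u; rewrite in_cons => /predU1P[->|];
      [|exact: cs].
  pose meets d := exists u, [/\ u \in s, ~ below v u & ~ agree_below u d 1].
  pose X1 := [set d | Min d /\ meets d];
    pose X2 := [set d | Min d /\ ~ meets d].
  pose B1 := generated X1; pose B2 := generated X2.
  have sB1 : subgroup B1 by exact: generated_subgroup.
  have sB2 : subgroup B2 by exact: generated_subgroup.
  have B12 a e : B1 a -> B2 e -> commute a e.
    move=> B1a; apply: generated_commute => e' [Me' nme'].
    apply/commute_sym; move: a B1a;
      apply: generated_commute => a' [Ma' [u [us nvu a'u]]].
    have Lu : level T m u by apply: Ls; rewrite in_cons us orbT.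
    apply: minimal_support_commute Lu _ a'u => //.
    by apply: contrapT => e'u; apply: nme'; exists u.
  have B2B : B2 `<=` B.
    by apply: generated_min => // d [Md _]; exact: sub_generated.
  have B1D : B1 `<=` D by apply: generated_sub_level_part => d [].
  have BB12 : B `<=` mul_set B1 B2.
    apply: generated_min.
      apply: subgroup_mul_set => // a e B1a B2e.
      by rewrite (B12 _ _ B1a B2e) mulgK.
    move=> d Md; have [md|nmd] := pselect (meets d).
      exists d, 1; rewrite mulg1; split=> //; last by case: sB2.
      by apply: sub_generated.
    exists 1, d; rewrite mul1g; split=> //; first by case: sB1.
    by apply: sub_generated.
  have [_ /(_ w Lw)[_ /BB12[a [e [B1a B2e ->]]] tae]] := Ct.
  have De := BD _ (B2B _ B2e); have Da := B1D _ B1a.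
  have [_ BM BV] := sB.
  pose c' := c * e^-1.
  have Mc' : M c' by apply: MM => //; apply: MV; case: De.
  have fixD u d : level T m u -> D d -> d u = u by exact: level_part_fix.
  have c's u : u \in s -> ~ below v u -> agree_below u c' 1.
    move=> us nvu; have Lu : level T m u by apply: Ls; rewrite in_cons us orbT.
    have eu : agree_below u e 1.
      move: e B2e {tae De c' Mc'}; apply: generated_min;
        first exact: agree_subgroup.
      by move=> d [_ nmd]; apply: contrapT => du; apply: nmd; exists u.
    have -> : 1 = 1 * 1^-1 :> aut T by rewrite !gnorm.
    apply: agreeM; [exact/aut_fixV/fixD|exact: cs|].
    by apply: agreeV => //; exact: fixD.
  have c'a : agree_below w c' a.
    have -> : a = 1 * (a * e) * e^-1 by rewrite !gnorm.
    have ew := fixD _ _ Lw De; have ew' := aut_fixV ew.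
    have tw := rist_level_fix Lw (CR _ Ct).
    rewrite /c' cE; apply: agreeM => //.
    by apply: agreeM => //; exact: xfix.
  have c'B1 d : B1 d -> commute c' d.
    apply: generated_commute => {}d [Md [u [us nvu du]]].
    have Lu : level T m u by apply: Ls; rewrite in_cons us orbT.
    by apply: minimal_support_commute_fix Lu _ du => //; exact: c's.
  have nB1 : normalised_by D B1.
    apply: generated_normalised => h d Dh [Md [u [us nvu du]]].
    split; first exact: minimal_support_level_normal.
    have Lu : level T m u by apply: Ls; rewrite in_cons us orbT.
    exists u; split=> //; have := agree1J h u d.
    by rewrite (fixD _ _ Lu Dh) => ->.
  have aw : agree_below w a 1.
    apply: agree1_of_commuting_conjugates => //; first by case: Da.
    move=> h Dh; pose k := h * a * h^-1.
    have B1k : B1 k by exact: nB1.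
    have kw := fixD _ _ Lw (B1D _ B1k); have aw := fixD _ _ Lw Da.
    have c'w : c' w = w by exact: agree_fix (agree_sym c'a) aw.
    apply: (@agree_trans _ w _ (c' * k)); first by apply/agree_sym;
      exact: agreeM.
    by rewrite (c'B1 _ B1k); exact: agreeM.
  exists c', (t * e^-1); split=> //.
  - by apply: (CM) => //; apply: CV; apply: BC; exact: B2B.
  - by rewrite /c' cE mulgA.
  - move=> u; rewrite in_cons => /predU1P[-> _|]; last exact: c's.
    exact: agree_trans c'a aw.
have /finite_seqP[s Es] := finite_level T m.
have [|c [t [Mc Ct cE cs]]] := key s; first by move=> u us; rewrite Es.
have tfix := rist_level_fixes_upto (CR _ Ct).
exists c; last by move=> c1; apply: xu0;
  rewrite -{1}(tfix _ _ Lu0) // -aut_mulE -cE c1.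
split=> // w nvw; have [k Lw] := level_exists w; have [km|/ltnW mk] := leqP k m.
  by rewrite cE aut_mulE (tfix k) //; case: Rx => _ ->.
have [u Lu uw] := ancestor Lw mk.
have us : u \in s by rewrite Es in Lu.
by apply: (cs u us) => // vu; apply: nvw; exact: below_trans uw.
Qed.

End Level.

(** * Nontriviality and finite index of the rigid stabilisers of [M] *)

(** The level [m] is that of a vertex moved by some [x] in [rist G v]. The subdirect case is
    [exists_rist]; in the other case [M] would meet [rist_level G m] trivially. *)
Lemma maximal_rist_neq1 v : rist M v <> [set 1].
Proof.
move=> Rv1.
have nontriv c : rist M v c -> c = 1 by rewrite Rv1.
have [x [w [Rx vw xw]]] := rist_moves sG (@ntG) v.
have [n Lv] := level_exists v; have [m Lw] := level_exists w.
have nm := below_level Lv Lw vw.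
have [DR|sdD] := rist_level_or_subdirect m; last first.
  by have [c /nontriv] := exists_rist sdD Lv nm Rx Lw xw.
have D1 g : M g -> rist_level G m g -> g = 1.
  move=> Mg Rg; suff R1 : rist_level M m `<=` [set 1] by apply: (R1); exact: DR.
  apply: rist_level_min; first by split=> [|_ _ -> ->|_ ->]; rewrite ?gnorm.
  (* [rist M u] is conjugate in [M] to [rist M w], which is contained in the trivial [rist M v]. *)
  move=> u Lu y Ry; have [h Mh hu] := maximal_level_transitive Lu Lw.
  have : rist M w (h * y * h^-1) by rewrite -hu; exact: rist_conj.
  move/(rist_subset vw)/nontriv/(congr1 (fun z => h^-1 * z * h)).
  by rewrite !gnorm.
have [y Ry /aut_neq1[z yz]] := rist_neq1 sG (@ntG w).
(* At level [j] the factor [t] of [y] fixes [z], and the factor [s] lies in [rist_level G m], so [s]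
   is trivial. *)
have [k Lz] := level_exists z; pose j := maxn m k.
have [u Lu _] := exists_below_level sG (@ntG) Lw (leq_maxl m k : m <= j).
have [s [t [Ms Rt yE]]] := prodense_rist_level Lu (rist_sub Ry).
have Rmt : rist_level G m t by apply: rist_level_subset Rt; exact: leq_maxl.
have [_ RM RV] := rist_level_subgroup G m.
have s1 : s = 1.
  apply: D1 => //; suff -> : s = y * t^-1.
    by apply: RM; [exact: sub_rist_level Lw _ Ry|exact: RV].
  by rewrite yE !gnorm.
apply: yz; rewrite yE s1 mul1g.
by apply: (rist_level_fixes_upto Rt) Lz _; exact: leq_maxr.
Qed.

Lemma maximal_finite_index_rist_level n : finite_index (rist_level M n) M.
Proof.
have [DR|sdD] := rist_level_or_subdirect n.
  apply: (finite_index_sub _ (rist_level_subgroup M n) DR);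
    first exact: level_part_subgroup.
  exact: finite_index_setI (rist_level_subgroup G n) sM MG (fG n).
have [v Lv] : exists v, level T n v.
  have L0 : level T 0 (@root T) by apply/levelE;
    rewrite (@root_path_unique _ root [::]).
  by have [v Lv _] := exists_below_level sG (@ntG) L0 (leq0n n); exists v.
have [x Rx x1] := rist_neq1 sM (@maximal_rist_neq1 v).
case: x1; apply: (@maximal_core_free (rist_level M n)).
- exact: rist_level_subgroup.
- exact: rist_level_sub.
- move=> g y Gg Ry; have [s [r [Ms Rr ->]]] := prodense_rist_level Lv Gg.
  suff Rry : rist_level M n (r * y * r^-1).
    by have := rist_level_normal sM Ms Rry; rewrite !gnorm.
  apply: generated_normalised Rr Ry => {}r {}y Rr [u Lu Ry].
  have [d [Md Rd] rd] := subdirect_rist_level sdD Lu Rr.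
  have ru := rist_level_fix Lu Rr.
  exists u => //; rewrite (rist_agree_conj Ry ru rd) -{1}(agree_fix rd ru).
  exact: rist_conj.
- exact: sub_rist_level Rx.
Qed.

End MaximalSubgroup.

Theorem theorem3p5 (T : rootedTree) (G M : set (aut T))
    (hG : branch_group G) (hM : maximal_subgroup M G)
    (hMinf : ~ finite_index M G) :
  branch_group M.
Proof.
split; first by case: hG.
- by case: hM.
- exact: maximal_level_transitive hMinf.
- exact: maximal_rist_neq1 hMinf.
- exact: maximal_finite_index_rist_level hMinf.
Qed.
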